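(* Let $k\ge 3$ be an integer and $t>1$ a real number. There exist constants $c,C>0$, depending only on $k$ and $t$, such that the following holds. Let $N\ge 1$ be an integer and $0<p<1$, let $X$ be the number of arithmetic progressions of length $k$ in the random set $[N]_p$, and let $\mu=\mathbb E X$. If $\mu\ge 1$ and $t\le p^{-k}$, then $$p^{CNp^{k/2}}=\exp\{-CNp^{k/2}\log(1/p)\}\le \mathbb P(X\ge t\mu)\le\exp\{-cNp^{k/2}\}.$$
   Context: $[N]=\{1,2,\dots,N\}$, and $[N]_p$ is the random subset of $[N]$ that includes each element independently with probability $p$. An arithmetic progression of length $k$ is regarded as a $k$-element set of (distinct) positive integers $\{x_1,\dots,x_k\}$ whose elements satisfy $x_i-2x_{i+1}+x_{i+2}=0$ for $i=1,\dots,k-2$; $X$ counts those sets contained in $[N]_p$, so $\mu$ equals $p^k$ times the number of such sets in $[N]$. *)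

(* Defs.v *)
From HB Require Import structures.
From mathcomp Require Import all_boot all_order all_algebra.
From mathcomp Require Import all_classical all_reals all_analysis.

Set Implicit Arguments.
Unset Strict Implicit.
Unset Printing Implicit Defensive.

Import Order.TTheory GRing.Theory Num.Theory.
Local Open Scope ring_scope.

(* The interval [N] = {1, ..., N} is encoded by 'I_N, the ordinal i standing
   for the integer i + 1. *)
Definition pos_of (N : nat) (i : 'I_N) : int := (i.+1)%:Z.

(* For x = (x_1, ..., x_k), the ordinal i < k - 2 below is the index i + 1 of
   the usual condition x_i - 2 x_(i+1) + x_(i+2) = 0 for i = 1, ..., k - 2.
   An increasing progression and its reversal enumerate the same set, so a
   progression is counted once. *)
Definition is_AP (N k : nat) (S : {set 'I_N}) : bool :=
  [exists x : k.-tuple 'I_N,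
    let v := [seq pos_of i | i <- x] in
    [&& uniq x, S == [set i in x] &
        [forall i : 'I_(k - 2), v`_i - 2 * v`_i.+1 + v`_i.+2 == 0]]].

Definition AP_count (N k : nat) (A : {set 'I_N}) : nat :=
  #|[set S : {set 'I_N} | is_AP k S & S \subset A]|.

Section BinomialSubset.
Variables (R : realType) (N : nat) (p : R).

(* The law of [N]_p: the product over i of Bernoulli(p) laws. *)
Definition binsub_law (A : {set 'I_N}) : R :=
  \prod_(i < N) (if i \in A then p else 1 - p).

Definition binsub_prob (E : pred {set 'I_N}) : R :=
  \sum_(A : {set 'I_N} | E A) binsub_law A.

Definition binsub_expect (f : {set 'I_N} -> R) : R :=
  \sum_(A : {set 'I_N}) binsub_law A * f A.

Lemma binsub_law_ge0 A : 0 <= p <= 1 -> 0 <= binsub_law A.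
Proof.
by move=> /andP[p0 p1]; apply: prodr_ge0 => i _; case: ifP; rewrite ?subr_ge0.
Qed.

(* The events "i is selected", i in [N], are mutually independent and each has
   probability p. *)
Lemma binsub_prob_sup (S : {set 'I_N}) :
  binsub_prob (fun A => S \subset A) = p ^+ #|S|.
Proof.
pose G (i : 'I_N) := if i \in S then 0 else 1 - p.
have : \prod_(i < N) (p + G i) =
    \sum_(A : {set 'I_N}) \prod_(i < N) (if i \in A then p else G i).
  by rewrite bigA_distr.
rewrite [X in _ = X](bigID (fun A : {set 'I_N} => S \subset A)) /=.
rewrite [X in _ + X]big1 ?addr0 => [|A /subsetPn[i iS iA]]; last first.
  by rewrite (bigD1 i) //= (negPf iA) /G iS mul0r.
move=> E; rewrite /binsub_prob; transitivity (\prod_(i : 'I_N) (p + G i)).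
  rewrite E; apply: eq_bigr => A /fintype.subsetP SA; apply: eq_bigr => i _.
  by case: ifPn => // iA; rewrite /G; case: ifPn => // /SA; rewrite (negPf iA).
rewrite (bigID (fun i => i \in S)) /= [X in _ * X]big1 ?mulr1; last first.
  by move=> i iS; rewrite /G (negPf iS) addrC subrK.
rewrite -prodr_const; apply: eq_bigr => i iS.
by rewrite /G iS addr0.
Qed.

Lemma binsub_prob_total : binsub_prob xpredT = 1.
Proof.
have := binsub_prob_sup finset.set0; rewrite cards0 expr0 => <-.
by apply: eq_bigl => A; rewrite finset.sub0set.
Qed.

End BinomialSubset.

Definition AP_mean (R : realType) (N k : nat) (p : R) : R :=
  binsub_expect p (fun A : {set 'I_N} => (AP_count k A)%:R).

(* P(X >= t * mu) *)
Definition AP_upper_tail (R : realType) (N k : nat) (p t : R) : R :=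
  binsub_prob p
    (fun A : {set 'I_N} => t * AP_mean N k p <= (AP_count k A)%:R).

Lemma AP_meanE (R : realType) (N k : nat) (p : R) :
  AP_mean N k p = p ^+ k * (AP_count k [set: 'I_N]%SET)%:R.
Proof.
transitivity (\sum_(S : {set 'I_N} | is_AP k S)
                binsub_prob p (fun A => S \subset A)).
  rewrite (exchange_big_dep xpredT) //=; apply: eq_bigr => A _.
  rewrite /AP_count cardsE -sum1_card natr_sum mulr_sumr.
  by apply: eq_big => [S|S _]; rewrite ?inE ?mulr1.
rewrite /AP_count -sum1_card natr_sum mulr_sumr.
apply: eq_big => [S|S /existsP[x /and3P[ux /eqP -> _]]].
  by rewrite !inE finset.subsetT andbT.
by rewrite binsub_prob_sup mulr1 cardsE (card_uniqP ux) size_tuple.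
Qed.

(* Main.v *)
Require Import Defs.
From HB Require Import structures.
From mathcomp Require Import all_boot all_order all_algebra.
From mathcomp Require Import all_classical all_reals all_analysis.
From mathcomp Require Import ring lra zify.

Set Implicit Arguments.
Unset Strict Implicit.
Unset Printing Implicit Defensive.

Import Order.TTheory GRing.Theory Num.Theory.
Local Open Scope ring_scope.

(** Write [X] for the number of progressions in the random set, [mu] for its
    mean and [y = N p^(k/2)].  Two distinct points lie in at most [k^2]
    progressions of length [k], so there are at most [(k N)^2] of them; as
    soon as there is one, there are also at least [(N / 2k)^2].  Hence [mu]
    and [y^2] agree up to constants depending on [k], and both bounds are
    about [sqrt mu].

    Upper bound.  This is a moment argument.  Expanding [E X^m] one factor at
    a time, each factor contributes the conditional mean of [X] given that
    some set [V] is selected, where [V] is the union of the fewer than [m]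
    progressions already exposed ([moment_le]).  That conditional mean is at
    most
      [mu + |V| N k^2 p^(k-1) + |V|^2 k^2],
    because a progression not disjoint from [V] meets it either in one point
    or in at least two ([sum_pow_diff_le]).  Since [p^(k-1) <= p^(k/2)], a set
    [V] of size [O(delta y)] makes the last two terms [O(delta mu)].  So for
    small [delta], depending on [k] and [t], and for [m] about [delta y], one
    gets [E X^m <= (mu (1 + t) / 2)^m], and Markov's inequality gives
    [P(X >= t mu) <= ((1 + t) / 2t)^m], which is exponentially small in [y].

    Lower bound.  It costs [p^M] to select all of an initial segment of
    length [M].  With [M = k q] that segment contains at least [q^2]
    progressions ([AP_count_initial]), so [M] of order [sqrt (t mu)], that is
    of order [y], forces [X >= t mu].  If this length exceeds [N], select all
    of [[N]]: then [X = mu / p^k >= t mu] by the assumption on [t]. *)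

(** * Moments of the number of selected members of a set system *)

Section Moments.
Variables (R : realType) (N : nat) (p : R).
Hypothesis p01 : 0 <= p <= 1.

(** [B] bounds the conditional mean of the number of selected members of [F]
    given that [V] is selected, for every [V] of size at most [L].  Carrying
    the event [U \subset A] along makes the induction on [m] work: one factor
    of the count is a sum over [S] in [F], and each [S] turns this event into
    [U :|: S \subset A].  The last of the [m] sets is never conditioned on,
    whence the extra [k] in the size condition. *)
Lemma moment_le (F : {set {set 'I_N}}) (k L : nat) (B : R) (m : nat)
    (U : {set 'I_N}) :
    (forall S, S \in F -> #|S| <= k)%N ->
    (forall V : {set 'I_N}, (#|V| <= L)%N ->
       \sum_(S in F) p ^+ #|S :\: V| <= B) ->
    0 <= B -> (#|U| + k * m <= L + k)%N ->
  binsub_expect p (fun A =>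
      (#|[set S in F | S \subset A]|%:R) ^+ m * (U \subset A)%:R)
    <= p ^+ #|U| * B ^+ m.
Proof.
move=> Fk FB B0; elim: m U => [|m IH] U Um.
  rewrite expr0 mulr1 -(binsub_prob_sup p U) /binsub_expect /binsub_prob.
  rewrite [leRHS]big_mkcond ler_sum // => A _.
  by rewrite expr0 mul1r; case: (U \subset A); rewrite ?mulr1 ?mulr0.
have -> : binsub_expect p (fun A : {set 'I_N} =>
      (#|[set S in F | S \subset A]|%:R) ^+ m.+1 * (U \subset A)%:R) =
    \sum_(S in F) binsub_expect p (fun A : {set 'I_N} =>
      (#|[set S in F | S \subset A]|%:R) ^+ m * (U :|: S \subset A)%:R).
  rewrite /binsub_expect exchange_big; apply: eq_bigr => A _ /=.
  rewrite -mulr_sumr -mulr_sumr exprSr -!mulrA; congr (_ * (_ * _)).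
  rewrite -sum1_card natr_sum mulr_suml big_mkcond [RHS]big_mkcond /=.
  apply: eq_bigr => S _; rewrite inE finset.subUset.
  case: (S \in F) => //=.
  by case: (S \subset A); case: (U \subset A); rewrite ?mulr1 ?mulr0.
apply: (@le_trans _ _ (\sum_(S in F) p ^+ #|U :|: S| * B ^+ m)).
  apply: ler_sum => S SF; apply: IH.
  have := (leq_card_setU U S).1; have := Fk _ SF.
  rewrite mulnS in Um; set a := #|_ :|: _|; lia.
rewrite -mulr_suml exprS mulrA ler_wpM2r ?exprn_ge0 //.
have -> : \sum_(S in F) p ^+ #|U :|: S| =
    p ^+ #|U| * \sum_(S in F) p ^+ #|S :\: U|.
  rewrite mulr_sumr; apply: eq_bigr => S _; rewrite -exprD; congr (_ ^+ _).
  rewrite cardsD finset.setIC; have := cardsUI U S.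
  by have := subset_leq_card (finset.subsetIr U S); lia.
rewrite ler_wpM2l ?exprn_ge0 //; first by case/andP: p01.
by apply: FB; lia.
Qed.

Lemma markov_moment (f : {set 'I_N} -> R) (x : R) (m : nat) :
    (forall A, 0 <= f A) -> 0 < x ->
  binsub_prob p (fun A => x <= f A)
    <= binsub_expect p (fun A => f A ^+ m) / x ^+ m.
Proof.
move=> f0 x0; rewrite ler_pdivlMr ?exprn_gt0 // mulr_suml big_mkcond.
apply: ler_sum => A _; case: ifP => [xf|_].
  by rewrite ler_wpM2l ?binsub_law_ge0 // lerXn2r ?nnegrE // ltW.
by rewrite mulr_ge0 ?binsub_law_ge0 // exprn_ge0.
Qed.

(** A member of [F] disjoint from [V] contributes [p ^+ k], one meeting [V] in a
    single point [p ^+ k.-1], and any other one at most [1].  The codegree bound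
    [D] limits the last class to [|V|^2 D] sets, and the second to [|V| N D],
    since a set of size at least 2 through [u] contains a second point. *)
Lemma sum_pow_diff_le (F : {set {set 'I_N}}) (k D : nat) (V : {set 'I_N}) :
    (2 <= k)%N -> (forall S, S \in F -> #|S| = k) ->
    (forall u v : 'I_N, u != v ->
       #|[set S in F | (u \in S) && (v \in S)]| <= D)%N ->
  \sum_(S in F) p ^+ #|S :\: V| <=
    p ^+ k * #|F|%:R + (#|V| * (N * D))%:R * p ^+ k.-1 + (#|V| * (#|V| * D))%:R.
Proof.
have [p0 p1] := andP p01 => k2 Fk FD.
have deg1 (u : 'I_N) : (#|[set S in F | u \in S]| <= N * D)%N.
  apply: (@leq_trans (\sum_(v | v != u)
      #|[set S in F | (u \in S) && (v \in S)]|)).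
    rewrite -sum1_card.
    under [leqRHS]eq_bigr do rewrite -sum1_card.
    rewrite (exchange_big_dep (mem [set S in F | u \in S])) /=; last first.
      by move=> v S _; rewrite !inE; case/and3P=> -> ->.
    apply: leq_sum => S; rewrite inE => /andP[SF uS].
    have : (1 < #|S|)%N by rewrite Fk.
    rewrite (cardsD1 u) uS ltnS card_gt0 => /set0Pn[v].
    rewrite !inE => /andP[vu vS].
    by rewrite (bigD1 v) //= inE SF uS vS vu.
  apply: (@leq_trans (\sum_(v < N | v != u) D)).
    by apply: leq_sum => v vu; apply: FD; rewrite eq_sym.
  by rewrite sum_nat_const leq_mul2r -[X in (_ <= X)%N]card_ord max_card orbT.
have deg2 (u : 'I_N) : (\sum_(v in V | v != u)
      #|[set S in F | (u \in S) && (v \in S)]| <= #|V| * D)%N.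
  apply: (@leq_trans (\sum_(v in V | v != u) D)).
    by apply: leq_sum => v /andP[_ vu]; apply: FD; rewrite eq_sym.
  rewrite sum_nat_const leq_mul2r.
  by apply/orP; right; apply/subset_leq_card/fintype.subsetP => v /andP[].
apply: (@le_trans _ _ (\sum_(S in F) (p ^+ k +
   \sum_(u in V) (u \in S)%:R * p ^+ k.-1 +
   \sum_(u in V) \sum_(v in V | v != u) ((u \in S) && (v \in S))%:R))).
  apply: ler_sum => S SF.
  set X1 := (X in _ <= _ + X + _); set X2 := (X in _ <= _ + X).
  have X1_ge0 : 0 <= X1.
    by apply: sumr_ge0 => u _; rewrite mulr_ge0 ?exprn_ge0 ?ler0n.
  have X2_ge0 : 0 <= X2 by do 2!(apply: sumr_ge0 => ? _); rewrite ler0n.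
  have pk0 : 0 <= p ^+ k by rewrite exprn_ge0.
  rewrite cardsD Fk //.
  case E : #|S :&: V| => [|[|j]].
  - by rewrite subn0 -addrA lerDl addr_ge0.
  - have /eqP/cards1P[u Eu] := E.
    have : u \in S :&: V by rewrite Eu inE.
    rewrite inE => /andP[uS uV].
    apply: (@le_trans _ _ X1); last by rewrite -addrA addrCA lerDl addr_ge0.
    rewrite /X1 (bigD1 u) //= uS mul1r subn1 lerDl.
    by apply: sumr_ge0 => v _; rewrite mulr_ge0 ?exprn_ge0 ?ler0n.
  have /card_gt1P[u [v [] ]] : (1 < #|S :&: V|)%N by rewrite E.
  rewrite !inE => /andP[uS uV] /andP[vS vV] uv.
  apply: (@le_trans _ _ X2); last by rewrite lerDr addr_ge0.
  apply: (@le_trans _ _ 1); first by rewrite exprn_ile1.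
  rewrite /X2 (bigD1 u) //= (bigD1 v) /=; last by rewrite vV eq_sym.
  rewrite uS vS -addrA lerDl addr_ge0 //.
    by apply: sumr_ge0 => ? _; rewrite ler0n.
  by do 2!(apply: sumr_ge0 => ? _); rewrite ler0n.
have count (P : pred {set 'I_N}) :
    \sum_(S in F) (P S)%:R = #|[set S in F | P S]|%:R :> R.
  rewrite -sum1_card natr_sum big_mkcond [RHS]big_mkcond.
  by apply: eq_bigr => S _; rewrite inE; case: (S \in F); case: (P S).
rewrite !big_split /=; apply: lerD; first apply: lerD.
- by rewrite sumr_const mulr_natr.
- rewrite exchange_big /= natrM mulr_natl mulrnAl -sumr_const.
  apply: ler_sum => u _; rewrite -mulr_suml count.
  by rewrite ler_wpM2r ?exprn_ge0 // ler_nat.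
- rewrite exchange_big /= natrM mulr_natl -sumr_const.
  apply: ler_sum => u _; rewrite exchange_big /=.
  under eq_bigr do rewrite count.
  by rewrite -natr_sum ler_nat.
Qed.
End Moments.

(** * Counting arithmetic progressions *)

(** Integer parameters allow [a] and [d] to be recovered by division from two
    terms, whatever their order. *)
Definition ap_set (N k : nat) (a d : int) : {set 'I_N} :=
  [set i : 'I_N | [exists l : 'I_k, pos_of i == a + d * (l : nat)%:Z]].

Lemma pos_of_inj (N : nat) : injective (@pos_of N).
Proof. by move=> i j /eqP; rewrite eqz_nat eqSS => /eqP /val_inj. Qed.

Lemma is_AP_ap_set (N k : nat) (S : {set 'I_N}) : is_AP k S ->
  exists a d : int, S = ap_set N k a d.
Proof.
move=> /existsP[x /and3P[_ /eqP -> /forallP xAP]].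
set v := [seq pos_of i | i <- x] in xAP.
exists v`_0, (v`_1 - v`_0).
have vE l : (l.+1 < k)%N ->
    v`_l = v`_0 + (v`_1 - v`_0) * l%:Z /\
    v`_l.+1 = v`_0 + (v`_1 - v`_0) * l.+1%:Z.
  elim: l => [|l IH] lk; first by rewrite mulr0 addr0 mulr1 addrC subrK.
  have [e1 e2] := IH (ltnW lk); split => //.
  have lk2 : (l < k - 2)%N by lia.
  have := xAP (Ordinal lk2); rewrite /= e1 e2 addrC addr_eq0 => /eqP ->.
  by rewrite !intS; ring.
have vE' l : (l < k)%N -> v`_l = v`_0 + (v`_1 - v`_0) * l%:Z.
  case: l => [|l lk]; first by rewrite mulr0 addr0.
  by case: (vE l lk).
apply/setP => i; rewrite !inE; apply/idP/existsP => [ix|[l /eqP il]].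
  have lk : (index i x < k)%N.
    by rewrite -[X in (_ < X)%N](size_tuple x) index_mem.
  exists (Ordinal lk); rewrite -vE' //.
  by rewrite /v (nth_map i) ?nth_index // size_tuple.
move: il; rewrite -vE' // (nth_map i) ?size_tuple // => /pos_of_inj ->.
by rewrite mem_nth ?size_tuple.
Qed.

Lemma AP_card (N k : nat) (S : {set 'I_N}) : is_AP k S -> #|S| = k.
Proof.
move=> /existsP[x /and3P[ux /eqP -> _]].
by rewrite cardsE (card_uniqP ux) size_tuple.
Qed.

(** The values of two terms and their positions [i != j] determine the common
    difference [(v - u) / (j - i)] and then the first term. *)
Lemma AP_pair_degree (N k : nat) (u v : 'I_N) : u != v ->
  (#|[set S : {set 'I_N} | is_AP k S & (u \in S) && (v \in S)]| <= k ^ 2)%N.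
Proof.
move=> uv.
pose g (ij : 'I_k * 'I_k) :=
  let d := ((pos_of v - pos_of u) %/ ((ij.2 : nat)%:Z - (ij.1 : nat)%:Z))%Z in
  ap_set N k (pos_of u - d * (ij.1 : nat)%:Z) d.
have -> : (k ^ 2 = #|{: 'I_k * 'I_k}|)%N by rewrite card_prod card_ord mulnn.
apply: leq_trans (leq_imset_card g _).
apply/subset_leq_card/fintype.subsetP => S; rewrite inE => /and3P[APS].
have [a [d ->]] := is_AP_ap_set APS.
rewrite !inE => /existsP[i /eqP ui] /existsP[j /eqP vj].
apply/imsetP; exists (i, j) => //; rewrite /g /=.
have ij : (j : nat)%:Z - (i : nat)%:Z != 0.
  apply: contraNneq uv => ji; apply/eqP/pos_of_inj; rewrite ui vj.
  by congr (_ + _ * _); lia.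
have -> : pos_of v - pos_of u = d * ((j : nat)%:Z - (i : nat)%:Z).
  by rewrite ui vj; ring.
by rewrite mulzK // ui addrK.
Qed.

Lemma ap_set_AP (N k a d : nat) :
  (0 < d)%N -> (a + d * k.-1 < N)%N -> (0 < k)%N ->
  is_AP k (ap_set N k a.+1%:Z d%:Z).
Proof.
case: N => // N d0 adN k0.
pose x := [tuple inord (a + d * l) : 'I_N.+1 | l < k].
have xE (l : nat) : (l < k)%N ->
    (inord (a + d * l) : 'I_N.+1) = (a + d * l)%N :> nat.
  by move=> lk; rewrite inordK //; nia.
have vE l : (l < k)%N -> [seq pos_of i | i <- x]`_l = (a + d * l).+1%:Z.
  move=> lk; rewrite (nth_map ord0) ?size_tuple //.
  rewrite -[l]/(nat_of_ord (Ordinal lk)) -tnth_nth tnth_mktuple /pos_of.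
  by rewrite xE.
apply/existsP; exists x; apply/and3P; split.
- rewrite map_inj_in_uniq ?enum_uniq // => i j _ _ /(congr1 val) /=.
  by rewrite !xE // => e; apply: val_inj => /=; nia.
- apply/eqP/setP => i; rewrite !inE; apply/existsP/mapP.
    move=> [l /eqP il]; exists l; first by rewrite mem_enum.
    by apply: val_inj; rewrite /= xE //; move: il; rewrite /pos_of; lia.
  by move=> [l _ ->]; exists l; rewrite /pos_of xE //; lia.
- apply/forallP => i; have ik := ltn_ord i.
  by rewrite !vE; [rewrite !mulnS; lia | lia..].
Qed.

Definition initial_segment (N M : nat) : {set 'I_N} :=
  [set i : 'I_N | (i < M)%N].

(** The [q ^ 2] progressions with first term among the first [q] positions and
    difference between 1 and [q] all end before [k * q]. *)
Lemma AP_count_initial (N k q : nat) : (2 <= k)%N -> (k * q <= N)%N ->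
  (q ^ 2 <= AP_count k (initial_segment N (k * q)))%N.
Proof.
move=> k2 kqN.
pose g (ad : 'I_q * 'I_q) := ap_set N k (ad.1).+1%:Z (ad.2).+1%:Z.
have -> : (q ^ 2 = #|{: 'I_q * 'I_q}|)%N by rewrite card_prod card_ord mulnn.
have bnd (a d : 'I_q) (l : nat) : (l < k)%N -> (a + d.+1 * l < k * q)%N.
  by move=> lk; have := ltn_ord a; have := ltn_ord d; nia.
rewrite -cardsT -(@card_in_imset _ _ g) => [|[a d] [a' d'] _ _ /= /setP E].
  apply/subset_leq_card/fintype.subsetP => _ /imsetP[[a d] _ ->]; rewrite inE.
  apply/andP; split.
    have k1 : (k.-1 < k)%N by lia.
    by rewrite /g /=; apply: ap_set_AP => //; [have := bnd a d _ k1; lia | lia].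
  apply/fintype.subsetP => i; rewrite !inE => /existsP[l].
  by rewrite /= /pos_of => /eqP il; have := bnd a d l (ltn_ord l); lia.
(* With [l = 0] and [l = 1]: the first two terms of each of two equal
   progressions occur in the other one.  The case [l = 0], used both ways,
   identifies the first terms, and then [l = 1] the differences. *)
have first2 (b e b' e' : 'I_q) (l : nat) : (l < 2)%N ->
    g (b, e) =i g (b', e') -> exists2 l' : nat, (l' < k)%N &
    (b + e.+1 * l = b' + e'.+1 * l')%N.
  move=> l2 E'; have lk : (l < k)%N by lia.
  have lN : (b + e.+1 * l < N)%N by have := bnd b e l lk; lia.
  have := E' (Ordinal lN); rewrite !inE /pos_of /=.
  have -> : [exists l0 : 'I_k,
      (b + e.+1 * l).+1%:Z == b.+1%:Z + e.+1%:Z * (l0 : nat)%:Z].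
    by apply/existsP; exists (Ordinal lk) => /=; lia.
  by move=> /esym/existsP[l' /eqP h]; exists l' => //; lia.
have [l1 _ h1] := first2 a d a' d' 0 isT E.
have [l2 _ h2] := first2 a' d' a d 0 isT (fun i => esym (E i)).
have [l3 _ h3] := first2 a d a' d' 1 isT E.
have [l4 _ h4] := first2 a' d' a d 1 isT (fun i => esym (E i)).
have aa : a = a' by apply: val_inj => /=; nia.
subst a'; congr (_, _); apply: val_inj => /=.
have l30 : (0 < l3)%N by case: l3 h3 => // h3; lia.
have l40 : (0 < l4)%N by case: l4 h4 => // h4; lia.
by nia.
Qed.

Lemma AP_count_le (N k : nat) : (2 <= k)%N ->
  (AP_count k [set: 'I_N]%SET <= (N * k) ^ 2)%N.
Proof.
move=> k2.
apply: (@leq_trans (\sum_(u < N) \sum_(v < N | v != u)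
   #|[set S : {set 'I_N} | is_AP k S & (u \in S) && (v \in S)]|)).
  rewrite pair_big_dep /=; under [leqRHS]eq_bigr do rewrite -sum1_card.
  rewrite (exchange_big_dep (is_AP k)) /=; last first.
    by move=> uv S _; rewrite inE => /and3P[].
  rewrite /AP_count -sum1_card.
  under eq_bigl do rewrite inE finset.subsetT andbT.
  apply: leq_sum => S APS.
  have /card_gt1P[u [v [uS vS uv]]] : (1 < #|S|)%N by rewrite (AP_card APS).
  by rewrite (bigD1 (u, v)) //= inE APS uS vS eq_sym uv.
apply: (@leq_trans (\sum_(u < N) \sum_(v < N) k ^ 2)).
  apply: leq_sum => u _; rewrite [leqLHS]big_mkcond; apply: leq_sum => v _.
  by case: ifP => // vu; apply: AP_pair_degree; rewrite eq_sym.
by rewrite !sum_nat_const card_ord mulnA mulnn expnMn.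
Qed.

Lemma card_initial_segment (N M : nat) : (#|initial_segment N M| <= M)%N.
Proof.
have -> : initial_segment N M = [set i : 'I_N | (i : nat) \in iota 0 M].
  by apply/setP => i; rewrite !inE mem_iota.
rewrite cardE -[X in (_ <= X)%N](size_iota 0 M) -(size_map val).
apply: uniq_leq_size.
  by rewrite map_inj_uniq ?enum_uniq //; exact: val_inj.
by move=> _ /mapP[i + ->]; rewrite mem_enum inE.
Qed.

(** A single progression forces [k <= N], so that [N %/ k] is positive and at
    least [N / (2 * k)]. *)
Lemma AP_count_ge (N k : nat) : (2 <= k)%N ->
  (0 < AP_count k [set: 'I_N]%SET)%N ->
  (N ^ 2 <= (2 * k) ^ 2 * AP_count k [set: 'I_N]%SET)%N.
Proof.
move=> k2; rewrite card_gt0 => /set0Pn[S]; rewrite inE => /andP[APS _].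
have kN : (k <= N)%N by rewrite -(AP_card APS) -[leqRHS]card_ord max_card.
have qN : (k * (N %/ k) <= N)%N by rewrite mulnC leq_divM.
have := AP_count_initial k2 qN.
have : (AP_count k (initial_segment N (k * (N %/ k)))
    <= AP_count k [set: 'I_N]%SET)%N.
  apply/subset_leq_card/fintype.subsetP => T; rewrite !inE => /andP[-> _].
  exact: finset.subsetT.
move=> le1 le2; have le3 := leq_trans le2 le1.
have : (N <= 2 * k * (N %/ k))%N.
  have := divn_eq N k; have := @ltn_pmod N k (ltnW k2).
  have : (0 < N %/ k)%N by rewrite divn_gt0 // ltnW.
  by move: (N %/ k)%N (N %% k)%N => q r; nia.
move: le3; set c := AP_count _ _.
rewrite -(leq_sqr N) expnMn => le3 /leq_trans; apply.
by rewrite leq_mul2l le3 orbT.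
Qed.

(** * The order of magnitude of the mean *)

Lemma half_powerP (R : realType) (p : R) (k : nat) :
    0 < p -> p < 1 -> (2 <= k)%N ->
  [/\ 0 < p `^ (k%:R / 2), (p `^ (k%:R / 2)) ^+ 2 = p ^+ k &
      p ^+ k.-1 <= p `^ (k%:R / 2)].
Proof.
move=> p0 p1 k2; have s0 : 0 < p `^ (k%:R / 2) by rewrite powR_gt0.
have s2 : (p `^ (k%:R / 2)) ^+ 2 = p ^+ k.
  by rewrite -powR_mulrn ?powR_ge0 // -powRrM divfK // powR_mulrn // ltW.
split=> //; rewrite -(@ler_pXn2r _ 2) ?nnegrE ?exprn_ge0 ?(ltW p0) ?(ltW s0) //.
rewrite s2 -exprM.
by apply: ler_wiXn2l; [exact: ltW | exact: ltW | lia].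
Qed.

(** The square root of the mean, up to constant factors depending on [k], once
    the mean is at least 1: see [AP_mean_le] and [AP_mean_ge]. *)
Definition scale (R : realType) (N k : nat) (p : R) : R :=
  N%:R * p `^ (k%:R / 2).

Lemma scale_ge0 (R : realType) (N k : nat) (p : R) : 0 <= scale N k p.
Proof. by rewrite mulr_ge0 ?powR_ge0. Qed.

Lemma AP_mean_le (R : realType) (N k : nat) (p : R) :
  (2 <= k)%N -> 0 < p -> p < 1 ->
  AP_mean N k p <= k%:R ^+ 2 * scale N k p ^+ 2.
Proof.
move=> k2 p0 p1; have [_ s2 _] := half_powerP p0 p1 k2.
rewrite AP_meanE exprMn s2 mulrA mulrC ler_wpM2r ?exprn_ge0 ?(ltW p0) //.
by rewrite -exprMn -natrM -natrX ler_nat mulnC AP_count_le.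
Qed.

Lemma AP_mean_ge (R : realType) (N k : nat) (p : R) :
  (2 <= k)%N -> 0 < p -> p < 1 -> 1 <= AP_mean N k p ->
  scale N k p ^+ 2 <= 4 * k%:R ^+ 2 * AP_mean N k p.
Proof.
move=> k2 p0 p1; rewrite AP_meanE => mu1.
have [_ s2 _] := half_powerP p0 p1 k2.
have c0 : (0 < AP_count k [set: 'I_N]%SET)%N.
  by rewrite lt0n; apply/eqP => c0; move: mu1; rewrite c0 mulr0 ler10.
rewrite exprMn s2 [leRHS]mulrCA mulrC ler_wpM2l ?exprn_ge0 ?(ltW p0) //.
have := AP_count_ge k2 c0; rewrite -(ler_nat R) natrM !natrX natrM exprMn.
by rewrite -(natrX R 2 2).
Qed.

(** * The two tail bounds *)

(** The number of moments used, as a fraction of [scale N k p].  It is chosen so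
    that each of the two error terms in the conditional mean is at most
    [4 * k ^+ 6 * rate k t * mu], hence at most a quarter of [(t - 1) * mu]. *)
Definition rate (R : realType) (k : nat) (t : R) : R :=
  (t - 1) / (16 * k%:R ^+ 6 * t).

Lemma rate_gt0 (R : realType) (k : nat) (t : R) :
  (2 <= k)%N -> 1 < t -> 0 < rate k t.
Proof.
move=> k2 t1; have k0 : 0 < k%:R :> R by rewrite ltr0n ltnW.
by rewrite divr_gt0 ?subr_gt0 // !mulr_gt0 //; lra.
Qed.

Section Tail.
Variables (R : realType) (k N : nat) (p t : R).
Let y : R := scale N k p.
Let mu : R := AP_mean N k p.
Let delta : R := rate k t.

(** Markov's inequality for the moment of order [n + 1], with [n] the integer
    part of [delta * y].  Only [n] progressions are ever conditioned on, so [V]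
    has at most [k * n <= k * delta * y] points, and this also covers the case
    [delta * y < 1], where [V] is empty. *)
Lemma upper_tail_exp :
    (2 <= k)%N -> 1 < t -> 0 < p -> p < 1 ->
    1 <= mu ->
  AP_upper_tail N k p t
    <= ((1 + t) / (2 * t)) ^+ (Num.truncn (delta * y)).+1.
Proof.
move=> k2 t1 p0 p1 mu1; set n := Num.truncn _.
have [s0 s2 ps] := half_powerP p0 p1 k2.
have p01 : 0 <= p <= 1 by rewrite !ltW.
have mu0 : 0 < mu by apply: lt_le_trans mu1.
have d0 := rate_gt0 k2 t1.
have nd : n%:R <= delta * y by rewrite truncn_le // mulr_ge0 ?scale_ge0 ?ltW.
pose F := [set S : {set 'I_N} | is_AP k S].
have Fk S : S \in F -> #|S| = k by rewrite inE => /AP_card.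
have FD (u v : 'I_N) : u != v ->
    (#|[set S in F | (u \in S) && (v \in S)]| <= k ^ 2)%N.
  move=> uv; rewrite (_ : [set _ in F | _] =
      [set S | is_AP k S & (u \in S) && (v \in S)]).
    exact: AP_pair_degree.
  by apply/setP => S; rewrite !inE.
have FB (V : {set 'I_N}) : (#|V| <= k * n)%N ->
    \sum_(S in F) p ^+ #|S :\: V| <= mu * ((1 + t) / 2).
  move=> Vn; apply: (le_trans (sum_pow_diff_le p01 V k2 Fk FD)).
  rewrite (_ : p ^+ k * #|F|%:R = mu); last first.
    rewrite /mu AP_meanE /AP_count; congr (_ * _%:R); apply: eq_card => S.
    by rewrite !inE finset.subsetT andbT.
  rewrite !natrM -expr2; set K : R := k%:R; set a : R := #|V|%:R.
  have K1 : 1 <= K by rewrite ler1n ltnW.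
  have K0 : 0 <= K by exact: ler0n.
  have a0 : 0 <= a by exact: ler0n.
  have ay : a <= K * (delta * y).
    apply: (@le_trans _ _ (k * n)%:R); first by rewrite ler_nat.
    by rewrite natrM ler_wpM2l ?ler0n.
  have y0 : 0 <= y by exact: scale_ge0.
  have dE : K ^+ 6 * delta * 16 * t = t - 1.
    rewrite /delta /rate -/K; field; lra.
  have K6 : 1 <= K ^+ 6 by exact: exprn_ege1.
  have Kd0 : 0 <= K ^+ 6 * delta.
    by rewrite mulr_ge0 ?(ltW d0) // (le_trans ler01).
  have Kd1 : K ^+ 6 * delta <= 1.
    rewrite -(@ler_pM2r _ t) ?(lt_trans ltr01) //.
    have : 0 <= K ^+ 6 * delta * t by rewrite mulr_ge0 //; lra.
    lra.
  have d1 : delta <= 1 by apply: le_trans Kd1; rewrite ler_peMl // ltW.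
  have yK : y ^+ 2 <= 4 * K ^+ 2 * mu by exact: AP_mean_ge.
  (* Progressions meeting [V] in one point; here [p ^+ k.-1 <= p ^ (k / 2)]
     turns [N * p ^+ k.-1] into at most [y]. *)
  have term1 : a * (N%:R * K ^+ 2) * p ^+ k.-1 <= 4 * (K ^+ 6 * delta) * mu.
    apply: (@le_trans _ _ (K ^+ 3 * delta * y ^+ 2)).
      rewrite (_ : K ^+ 3 * delta * y ^+ 2 =
          K * (delta * y) * (N%:R * K ^+ 2) * p `^ (k%:R / 2)).
        by rewrite ler_pM ?mulr_ge0 ?ler_wpM2r ?mulr_ge0 ?exprn_ge0 ?(ltW p0).
      by rewrite /y /scale; ring.
    apply: (@le_trans _ _ (K ^+ 3 * delta * (4 * K ^+ 2 * mu))).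
      by apply: ler_wpM2l yK; rewrite mulr_ge0 ?exprn_ge0 ?(ltW d0).
    rewrite [leRHS](_ : _ = K * (K ^+ 3 * delta * (4 * K ^+ 2 * mu))).
      2: by ring.
    rewrite ler_peMl // mulr_ge0 ?(mulr_ge0 (exprn_ge0 _ _) (ltW d0)) //.
    by rewrite mulr_ge0 ?(ltW mu0) // mulr_ge0 ?exprn_ge0.
  (* Progressions meeting [V] in two or more points. *)
  have term2 : a * (a * K ^+ 2) <= 4 * (K ^+ 6 * delta) * mu.
    apply: (@le_trans _ _ (K * (delta * y) * (K * (delta * y) * K ^+ 2))).
      by rewrite ler_pM ?ler_wpM2r ?mulr_ge0 ?exprn_ge0.
    (* One of the two factors [delta] is given away. *)
    rewrite (_ : K * (delta * y) * (K * (delta * y) * K ^+ 2) =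
        delta * (K ^+ 4 * delta * y ^+ 2)); last ring.
    apply: (@le_trans _ _ (K ^+ 4 * delta * y ^+ 2)).
      by rewrite ler_piMl // mulr_ge0 ?exprn_ge0 ?scale_ge0 // mulr_ge0
         ?exprn_ge0 ?(ltW d0).
    rewrite [leRHS](_ : _ = K ^+ 4 * delta * (4 * K ^+ 2 * mu)); last ring.
    by apply: ler_wpM2l yK; rewrite mulr_ge0 ?exprn_ge0 ?(ltW d0).
  have dmu : 16 * (K ^+ 6 * delta) * mu <= (t - 1) * mu.
    rewrite ler_pM2r // -dE.
    have : K ^+ 6 * delta <= K ^+ 6 * delta * t by rewrite ler_peMr // ltW.
    lra.
  have : 0 <= (t - 1) * mu by rewrite mulr_ge0 ?subr_ge0 // ltW.
  lra.
have tmu0 : 0 < t * mu by rewrite mulr_gt0 // (lt_trans ltr01).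
rewrite /AP_upper_tail.
apply: (le_trans (@markov_moment _ _ _ p01 _ _ n.+1 _ _)) => //.
rewrite ler_pdivrMr ?exprn_gt0 //.
rewrite -exprMn.
have B0 : 0 <= mu * ((1 + t) / 2) by rewrite mulr_ge0 ?ltW //; lra.
have size0 : (#|finset.set0 : {set 'I_N}| + k * n.+1 <= k * n + k)%N.
  by rewrite cards0 add0n mulnSr.
have Fk' S : S \in F -> (#|S| <= k)%N by move=> /Fk ->.
have := moment_le p01 Fk' FB B0 size0; rewrite cards0 mul1r.
have -> : (1 + t) / (2 * t) * (t * AP_mean N k p) = mu * ((1 + t) / 2).
  by rewrite /mu; field; lra.
apply: le_trans; rewrite le_eqVlt; apply/orP; left; apply/eqP.
apply: eq_bigr => A _; rewrite finset.sub0set mulr1; congr (_ * _%:R ^+ _).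
by apply: eq_card => S; rewrite !inE.
Qed.

Lemma upper_tail_le :
    (2 <= k)%N -> 1 < t -> 0 < p -> p < 1 ->
    1 <= mu ->
  AP_upper_tail N k p t <= expR (- (delta * ln (2 * t / (1 + t)) * y)).
Proof.
move=> k2 t1 p0 p1 mu1.
apply: (le_trans (upper_tail_exp k2 t1 p0 p1 mu1)).
have r0 : 0 < (1 + t) / (2 * t) by rewrite divr_gt0; lra.
have -> : ln (2 * t / (1 + t)) = - ln ((1 + t) / (2 * t)).
  by rewrite -lnV ?posrE // invf_div.
rewrite -[X in X ^+ _](@lnK _ _) ?posrE // -expRM_natl ler_expR.
have -> : - (delta * - ln ((1 + t) / (2 * t)) * y) =
    delta * y * ln ((1 + t) / (2 * t)) by ring.
rewrite ler_wnM2r //.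
  by rewrite ln_le0 // ler_pdivrMr; lra.
by rewrite ltW // truncnS_gt.
Qed.

(** The threshold [t * mu] is at most [w ^+ 2] with [w = sqrt t * k * y >= 1],
    so an initial segment of length [k * q] with [w < q <= 2 * w] is long
    enough, or else all of the ground set is. *)
Lemma lower_tail_ge :
    (2 <= k)%N -> 1 < t -> 0 < p -> p < 1 ->
    1 <= mu -> t <= p ^- k ->
  expR (2 * Num.sqrt t * k%:R ^+ 2 * y * ln p) <= AP_upper_tail N k p t.
Proof.
move=> k2 t1 p0 p1 mu1 tp.
have p01 : 0 <= p <= 1 by rewrite !ltW.
have t0 : 0 <= t by lra.
have st1 : 1 <= Num.sqrt t by rewrite -sqrtr1 ler_sqrt // ltW.
have k0 : 0 < k%:R :> R by rewrite ltr0n ltnW.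
have ky1 : 1 <= k%:R * y.
  have ky0 : 0 <= k%:R * y by rewrite mulr_ge0 ?scale_ge0 // ltW.
  rewrite -(@ler_pXn2r _ 2) ?nnegrE // expr1n exprMn.
  exact: le_trans mu1 (AP_mean_le N k2 p0 p1).
set w := Num.sqrt t * (k%:R * y).
have w1 : 1 <= w by rewrite /w -[leLHS]mulr1 ler_pM.
pose q := (Num.truncn w).+1.
have qw : q%:R <= 2 * w.
  rewrite /q -natr1; have : (Num.truncn w)%:R <= w by rewrite truncn_le; lra.
  lra.
have wq : t * mu <= (q ^ 2)%:R.
  apply: (@le_trans _ _ (w ^+ 2)).
    rewrite exprMn sqr_sqrtr // exprMn ler_pM2l ?AP_mean_le //; lra.
  have : w < q%:R by rewrite truncnS_gt.
  by rewrite natrX => wq; rewrite ler_pXn2r ?nnegrE //; lra.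
have [U [Uq Ut]] : exists U : {set 'I_N}, (#|U| <= k * q)%N /\
    t * mu <= (AP_count k U)%:R.
  have [kqN|Nkq] := leqP (k * q) N.
    exists (initial_segment N (k * q)); split.
      exact: card_initial_segment.
    by apply: le_trans wq _; rewrite ler_nat AP_count_initial.
  exists [set: 'I_N]%SET; split; first by rewrite cardsT card_ord ltnW.
  rewrite /mu AP_meanE mulrA ler_piMl //.
  by rewrite -ler_pdivlMr ?exprn_gt0 // div1r.
apply: (@le_trans _ _ (p ^+ #|U|)).
  have -> : p ^+ #|U| = expR (#|U|%:R * ln p) by rewrite expRM_natl lnK ?posrE.
  rewrite ler_expR.
  rewrite ler_wnM2r ?ln_le0 ?(ltW p1) //.
  apply: (@le_trans _ _ (k * q)%:R); first by rewrite ler_nat.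
  rewrite natrM (_ : 2 * _ * _ * y = k%:R * (2 * w)); last by rewrite /w; ring.
  by rewrite ler_wpM2l // ltW.
rewrite -(binsub_prob_sup p U) /AP_upper_tail /binsub_prob.
rewrite big_mkcond [leRHS]big_mkcond; apply: ler_sum => A _.
case: ifP => UA; last by case: ifP => // _; exact: binsub_law_ge0.
rewrite ifT //; apply: le_trans Ut _; rewrite ler_nat.
apply/subset_leq_card/fintype.subsetP => S; rewrite !inE => /andP[-> SU] /=.
exact: fintype.subset_trans SU UA.
Qed.
End Tail.

Theorem corollary2p4 (R : realType) (k : nat) (t : R)
    (hk : (3 <= k)%N) (ht : 1 < t) :
  exists c C : R, 0 < c /\ 0 < C /\
    forall (N : nat) (p : R), (1 <= N)%N -> 0 < p -> p < 1 ->
      1 <= AP_mean N k p -> t <= p ^- k ->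
      p `^ (C * N%:R * p `^ (k%:R / 2))
        = expR (- (C * N%:R * p `^ (k%:R / 2) * ln (1 / p))) /\
      expR (- (C * N%:R * p `^ (k%:R / 2) * ln (1 / p)))
        <= AP_upper_tail N k p t /\
      AP_upper_tail N k p t <= expR (- (c * N%:R * p `^ (k%:R / 2))).
Proof.
have k2 : (2 <= k)%N := ltnW hk.
exists (rate k t * ln (2 * t / (1 + t))).
exists (2 * Num.sqrt t * k%:R ^+ 2); split; [|split].
- apply: mulr_gt0; first exact: rate_gt0.
  by apply: ln_gt0; rewrite ltr_pdivlMr; lra.
- rewrite !mulr_gt0 ?exprn_gt0 ?sqrtr_gt0 ?ltr0n; try lra; lia.
move=> N p _ p0 p1 mu1 tp.
have E a : a * N%:R * p `^ (k%:R / 2) = a * scale N k p by rewrite /scale mulrA.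
rewrite div1r lnV ?posrE // mulrN opprK !E; split; [|split].
- by rewrite /powR gt_eqF.
- exact: lower_tail_ge.
- exact: upper_tail_le.
Qed.
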